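(* Let $\kappa \in \mathcal{S}_{-1}$, let $k$ be its associate Sonine kernel, and let $n\in\mathbb{N}$. Then: (i) the $n$-fold general fractional derivative $\mathbb{D}_{(k)}^n$ in the Riemann--Liouville sense is a left inverse operator to the $n$-fold general fractional integral $\mathbb{I}_{(\kappa)}^n$ on the space $C_{-1}(0,+\infty)$, i.e. $$(\mathbb{D}_{(k)}^n\, \mathbb{I}_{(\kappa)}^n\, f)(t) = f(t),\quad f\in C_{-1}(0,+\infty),\ t>0;$$ (ii) the $n$-fold general fractional derivative ${}_*\mathbb{D}_{(k)}^n$ in the Caputo sense is a left inverse operator to $\mathbb{I}_{(\kappa)}^n$ on the space $C_{-1,k}^n(0,+\infty) := \{f:\ f(t)=(\mathbb{I}_{(k)}^n\, \phi)(t),\ \phi\in C_{-1}(0,+\infty)\}$, i.e. $$({}_*\mathbb{D}_{(k)}^n\, \mathbb{I}_{(\kappa)}^n\, f)(t) = f(t),\quad f\in C_{-1,k}^n(0,+\infty),\ t>0.$$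
   Context: $C_{-1}(0,+\infty)$ is the set of functions $f$ on $(0,+\infty)$ that can be written as $f(t)=t^{p-1}f_1(t)$, $t>0$, for some $p>0$ and some $f_1\in C[0,+\infty)$. $C_{-1,0}(0,+\infty)$ is the set of functions $f$ on $(0,+\infty)$ that can be written as $f(t)=t^{p-1}f_1(t)$, $t>0$, for some $0<p<1$ and some $f_1\in C[0,+\infty)$. (The exponents $p$ depend on $f$.) $\mathbb{N}=\{1,2,\dots\}$. The Laplace convolution is $(f*g)(t)=\int_0^t f(t-\tau)g(\tau)\,d\tau$, $t>0$. For $\kappa\in C_{-1}(0,+\infty)$, $\kappa^n:=\underbrace{\kappa*\cdots*\kappa}_{n}$ denotes the $n$-th convolution power (not the pointwise power). $\kappa\in\mathcal{S}_{-1}$ means that $\kappa\in C_{-1,0}(0,+\infty)$ and there is $k\in C_{-1,0}(0,+\infty)$ with $(\kappa*k)(t)=1$ for all $t>0$ (the Sonine condition). Such a $k$ is unique, also belongs to $\mathcal{S}_{-1}$, and is called the associate Sonine kernel of $\kappa$. For a kernel $\kappa\in\mathcal{S}_{-1}$ the $n$-fold general fractional integral is the $n$-fold composition of $f\mapsto \kappa*f$, i.e. $(\mathbb{I}_{(\kappa)}^n f)(t)=(\kappa^n*f)(t)$, $t>0$; $\mathbb{I}_{(k)}^n$ is the same operator with the kernel $k$. The $n$-fold general fractional derivatives in the Riemann--Liouville and Caputo senses are $$(\mathbb{D}_{(k)}^n f)(t):=\frac{d^n}{dt^n}(k^n*f)(t),\qquad ({}_*\mathbb{D}_{(k)}^n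 f)(t):=(\mathbb{D}_{(k)}^n f)(t)-\sum_{j=0}^{n-1}f^{(j)}(0)\,\frac{d^{n-j-1}}{dt^{n-j-1}}k^n(t),\qquad t>0,$$ where $f^{(j)}(0)$ means $\lim_{t\to0+}f^{(j)}(t)$. *)

(* Defs.v *)
From HB Require Import structures.
From mathcomp Require Import all_boot all_order all_algebra.
From mathcomp Require Import all_classical all_reals all_analysis.

Set Implicit Arguments.
Unset Strict Implicit.
Unset Printing Implicit Defensive.

Import Order.TTheory GRing.Theory Num.Theory.
Import numFieldNormedType.Exports.

Local Open Scope ring_scope.
Local Open Scope classical_set_scope.

(* A function on (0,+oo) is represented by a total function R -> R; only its
   values at t > 0 matter, and equalities are always restricted to t > 0. *)
Section GeneralFractionalCalculus.
Context {R : realType}.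
Implicit Types (f kappa k : R -> R) (n : nat).

Definition C_m1 : set (R -> R) :=
  [set f | exists (p : R) (f1 : R -> R),
     [/\ 0 < p, {within `[0, +oo[, continuous f1}
       & forall t, 0 < t -> f t = t `^ (p - 1) * f1 t]].

Definition C_m1_0 : set (R -> R) :=
  [set f | exists (p : R) (f1 : R -> R),
     [/\ 0 < p < 1, {within `[0, +oo[, continuous f1}
       & forall t, 0 < t -> f t = t `^ (p - 1) * f1 t]].

(* The integrand may be singular at both end points; for functions of C_m1 it
   is Lebesgue integrable over the open interval. *)
Definition laplace_conv f (g : R -> R) (t : R) : R :=
  (\int[lebesgue_measure]_(tau in `]0, t[) (f (t - tau) * g tau))%R.

(* Convolution power kappa * ... * kappa with n factors. There is no unit for
   the convolution, so n = 0 is meaningless (the value is then kappa). *)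
Definition conv_pow kappa n : R -> R :=
  iter n.-1 (laplace_conv kappa) kappa.

Definition associate_kernel kappa k : Prop :=
  C_m1_0 k /\ forall t, 0 < t -> laplace_conv kappa k t = 1.

Definition sonine_kernels : set (R -> R) :=
  [set kappa | C_m1_0 kappa /\ exists k, associate_kernel kappa k].

Definition GFI kappa n f : R -> R := iter n (laplace_conv kappa) f.

(* [f^`(n)] is total, with an unspecified value where the derivative does not
   exist; this predicate says that the first n derivatives exist on (0,+oo). *)
Definition derivable_pos n f : Prop :=
  forall i, (i < n)%N -> forall t : R, 0 < t -> derivable f^`(i) t 1.

Definition GFD_RL k n f : R -> R := (laplace_conv (conv_pow k n) f)^`(n).

Definition GFD_RL_exists k n f : Prop :=
  derivable_pos n (laplace_conv (conv_pow k n) f).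

Definition deriv_at0 j f : R := lim (f^`(j) t @[t --> 0^'+]).

Definition GFD_C k n f (t : R) : R :=
  GFD_RL k n f t -
  \sum_(j < n) deriv_at0 j f * derive1n (n - j - 1) (conv_pow k n) t.

(* A kernel of C_m1_0 need not be differentiable, so a term of the sum whose
   coefficient f^(j)(0) vanishes is counted as 0 even if the derivative of k^n
   in it does not exist. *)
Definition GFD_C_exists k n f : Prop :=
  [/\ GFD_RL_exists k n f,
      derivable_pos n.-1 f,
      forall j, (j < n)%N -> cvg (f^`(j) t @[t --> 0^'+])
    & forall j, (j < n)%N -> deriv_at0 j f != 0 ->
        derivable_pos (n - j - 1) (conv_pow k n)].

Definition C_m1_pow k n : set (R -> R) :=
  [set f | exists2 phi, C_m1 phi & forall t, 0 < t -> f t = GFI k n phi t].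

End GeneralFractionalCalculus.

(* Main.v *)
Require Import Defs.
From HB Require Import structures.
From mathcomp Require Import all_boot all_order all_algebra.
From mathcomp Require Import all_classical all_reals all_analysis.
From mathcomp Require Import measurable_realfun zify ring lra.
Import Order.TTheory GRing.Theory Num.Theory.
Import numFieldNormedType.Exports.
Local Open Scope ring_scope.
Local Open Scope classical_set_scope.

(** Convolution makes [C_m1] a commutative associative algebra: for
    [f t = t `^ (p - 1) * F t] and [g t = t `^ (q - 1) * G t], the substitution
    [tau = t * s] gives [(f * g) t = t `^ (p + q - 1) * H t], where [H t] is the
    integral of [(1 - s) `^ (p - 1) * s `^ (q - 1) * F (t * (1 - s)) * G (t * s)]
    over [0 < s < 1] and is continuous by dominated convergence; associativity
    is Fubini. Since [kappa * k = 1], the operators [k^n *] and [kappa^n *]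
    compose to the n-fold iterate of integration from 0, which is undone by n
    derivatives. If moreover [f = k^n * phi], then [kappa^n * f] is the n-fold
    integral of [phi], whose derivatives of order [j < n] tend to 0 at 0+, so
    the Caputo correction terms vanish. *)

(** * Lebesgue integrals under affine substitutions *)

Lemma measurable_affine {R : realType} (c d : R) :
  measurable_fun setT (fun x : R => c * x + d).
Proof.
apply: continuous_measurable_fun => x.
by apply: cvgD; [apply: cvgM; [exact: cvg_cst|exact: cvg_id]|exact: cvg_cst].
Qed.

Section AffineChangeOfVariable.
Context {R : realType}.
Let mu := @lebesgue_measure R.
Variables c d : R.
Hypothesis c0 : c != 0.
Let aff : measurableTypeR R -> measurableTypeR R := fun x => c * x + d.

Let maff : measurable_fun setT aff. Proof. exact: measurable_affine. Qed.

(* The measure instance is applied by hand: unification cannot find [maff]. *)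
Let nu : {measure set (measurableTypeR R) -> \bar R} :=
  measure_function_pushforward__canonical__measure_function_Measure mu maff.

Let cnu : {measure set (measurableTypeR R) -> \bar R} :=
  mscale (NngNum (normr_ge0 c)) nu.

(** Lebesgue measure is determined by its values on half-open intervals, so only those are compared.
    For [c < 0] the preimage of such an interval is closed on the left and open on the right, with
    the same length formula. *)
Lemma lebesgue_measure_affine (A : set R) : measurable A ->
  (`|c|%:E * mu (aff @^-1` A) = mu A)%E.
Proof.
move=> mA; apply/esym; have := @lebesgue_measure_unique R cnu.
apply=> //= _ [[u v]] _ <-.
change (mu `]u, v] = `|c|%:E * mu (aff @^-1` `]u, v]))%E.
have [cgt0|clt0|ceq0] := ltgtP 0 c; last by case/eqP: c0.
- have -> : aff @^-1` `]u, v] = `](u - d) / c, (v - d) / c]%classic.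
    apply/seteqP; split=> x /=; rewrite !in_itv/= ltr_pdivrMr// ler_pdivlMr//;
    by rewrite ltrBlDr lerBrDr /aff (mulrC c).
  rewrite /mu !lebesgue_measure_itv/= !lte_fin ltr_pM2r ?invr_gt0// ltrD2r.
  case: ifPn => uv; last by rewrite mule0.
  by rewrite -!EFinB -EFinM gtr0_norm//; congr EFin; field.
- have -> : aff @^-1` `]u, v] = `[(v - d) / c, (u - d) / c[%classic.
    apply/seteqP; split=> x /=; rewrite !in_itv/= ltr_ndivlMr// ler_ndivrMr//;
    by rewrite ltrBlDr lerBrDr /aff (mulrC c) andbC.
  rewrite /mu !lebesgue_measure_itv/= !lte_fin ltr_nM2r ?invr_lt0// ltrD2r.
  case: ifPn => uv; last by rewrite mule0.
  by rewrite -!EFinB -EFinM ltr0_norm//; congr EFin; field.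
Qed.

Lemma ge0_integral_affine (f : R -> \bar R) : measurable_fun setT f ->
  (forall x, 0 <= f x)%E ->
  (`|c|%:E * \int[mu]_x f (c * x + d)%R = \int[mu]_x f x)%E.
Proof.
move=> mf f0.
transitivity (\int[cnu]_x f x)%E.
  by rewrite ge0_integral_mscale// ge0_integral_pushforward.
by apply: eq_measure_integral => A mA _; exact: lebesgue_measure_affine.
Qed.

Lemma integral_affine (f : R -> \bar R) : measurable_fun setT f ->
  (`|c|%:E * \int[mu]_x f (c * x + d)%R = \int[mu]_x f x)%E.
Proof.
move=> mf; have cp : (0 < `|c|)%R by rewrite normr_gt0.
rewrite -[in LHS]/((f \o aff) _) [in LHS]integralE [RHS]integralE.
rewrite funepos_comp funeneg_comp.
rewrite -(@ge0_integral_affine f^\+)%E//; last exact: measurable_funepos.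
rewrite -(@ge0_integral_affine f^\-)%E//; last exact: measurable_funeneg.
have : (0 <= \int[mu]_x f^\+ (c * x + d)%R)%E by exact: integral_ge0.
have : (0 <= \int[mu]_x f^\- (c * x + d)%R)%E by exact: integral_ge0.
rewrite /=.
(* Either part may have an infinite integral; the indeterminate difference is [-oo] by convention,
   and multiplication by [|c| > 0] preserves that value. *)
set u := integral _ _ _; set v := integral _ _ _.
case: u => [r| |]//; case: v => [s| |]// _ _.
- by congr EFin; rewrite mulrBr.
- by rewrite addye// gt0_muley ?lte_fin.
- by rewrite addeNy gt0_muley ?lte_fin// gt0_muleNy ?lte_fin.
- by rewrite addeNy gt0_muley ?lte_fin// gt0_muleNy ?lte_fin.
Qed.

Lemma integrable_affine (f : R -> \bar R) :
  mu.-integrable setT f -> mu.-integrable setT (fun x => f (c * x + d)).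
Proof.
move=> /integrableP[mf fi]; apply/integrableP; split.
  exact: (measurableT_comp mf maff).
have maf : measurable_fun setT (abse \o f) by exact: measurableT_comp mf.
move: fi; rewrite -(ge0_integral_affine _ maf (fun=> abse_ge0 _)).
have : (0 <= \int[mu]_x `|f (c * x + d)%R|)%E by exact: integral_ge0.
rewrite /=; set u := integral _ _ _; case: u => [r _ _| |]//.
  by rewrite ltry.
by rewrite gt0_muley ?lte_fin ?normr_gt0.
Qed.
End AffineChangeOfVariable.

(** * Power functions near 0 *)

Lemma continuous_powR_gt0 {R : realType} (p x : R) : 0 < x ->
  {for x, continuous (@powR R ^~ p)}.
Proof.
move=> x0; apply: differentiable_continuous; apply/derivable1_diffP.
by apply: derivable_powR; rewrite in_itv/= x0.
Qed.

Section PowerWeight.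
Context {R : realType}.
Let mu := @lebesgue_measure R.

Lemma integrable_powR01 (q : R) : 0 < q ->
  mu.-integrable `]0, 1[ (fun s => (s `^ (q - 1))%:E).
Proof.
move=> q0; suff : mu.-integrable `]0, 1] (fun s => (s `^ (q - 1))%:E).
  by apply: integrableS => //; apply: subset_itvl; rewrite bnd_simp.
have mp D : measurable D ->
    measurable_fun D (fun s : R => (s `^ (q - 1))%:E).
  move=> mD; apply/measurable_EFinP; apply: measurable_funTS.
  exact: measurable_powR.
apply/integrableP; split; first exact: mp.
under eq_integral do rewrite gee0_abs ?lee_fin ?powR_ge0//.
rewrite itv_open_bnd_bigcup.
pose F n : set R := `[0 + n.+1%:R^-1, 1].
have ndF : nondecreasing_seq F.
  apply/nondecreasing_seqP => n; rewrite subsetEset; apply: subset_itvr.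
  by rewrite bnd_simp lerD2l lef_pV2 ?posrE ?ltr0n// ler_nat.
have mF n : measurable (F n) by exact: measurable_itv.
have g0 n x : F n x -> (0 <= (x `^ (q - 1))%:E)%E by rewrite lee_fin powR_ge0.
have Fcvg := ge0_nondecreasing_set_cvg_integral (mu := mu) ndF mF
  (fun n => mp _ (mF n)) g0.
rewrite -[X in (X < _)%E](cvg_lim _ Fcvg)//.
apply: (@le_lt_trans _ _ (q^-1)%:E); last by rewrite ltry.
apply: lime_le; first by apply: cvgP Fcvg.
apply: nearW => n; rewrite /F add0r.
have n0 : 0 < n.+1%:R^-1 :> R by rewrite invr_gt0 ltr0n.
have : n.+1%:R^-1 <= 1 :> R by rewrite invf_le1 ?ltr0n// ler1n.
(* When [1 / (n + 1) = 1] the interval is a single point, which is treated apart from the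
   fundamental theorem of calculus. *)
rewrite le_eqVlt => /predU1P[->|n1].
  by rewrite set_itv1 integral_set1 lee_fin invr_ge0 ltW.
have dp (x : R) : 0 < x -> is_derive x 1 (fun s => q^-1 * s `^ q) (x `^ (q - 1)).
  move=> x0.
  have dz := @is_deriveZ _ _ _ (@powR R ^~ q) q^-1 _ _ _ (is_derive1_powR q x0).
  apply: is_derive_eq dz _.
  by rewrite /GRing.scale/= mulrA mulVf ?gt_eqF// mul1r.
rewrite (@continuous_FTC2 _ _ (fun s => q^-1 * s `^ q))//.
- by rewrite -EFinB lee_fin powR1 mulr1 gerBl mulr_ge0 ?invr_ge0 ?powR_ge0 ?ltW.
- apply: continuous_in_subspaceT => x /set_mem /=.
  rewrite in_itv/= => /andP[nx _].
  by apply: continuous_powR_gt0; exact: lt_le_trans nx.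
- split.
  + move=> x; rewrite in_itv/= => /andP[nx _].
    by have [] := dp x (lt_trans n0 nx).
  + apply: cvg_at_right_filter; apply: cvgM; first exact: cvg_cst.
    exact: continuous_powR_gt0.
  + apply: cvg_at_left_filter; apply: cvgM; first exact: cvg_cst.
    exact: continuous_powR_gt0.
- move=> x; rewrite in_itv/= => /andP[nx _]; rewrite derive1E.
  by have [_ ->] := dp x (lt_trans n0 nx).
Qed.
End PowerWeight.

(** * Extension by zero and beta-type integrals *)

Section ZeroExtension.
Set Implicit Arguments.
Unset Strict Implicit.
Context {R : realType}.
Let mu := @lebesgue_measure R.

(** With this cut-off a convolution is an integral over the whole line, so substitutions and Fubini
    involve no moving domains. *)
Definition ext0 (f : R -> R) (x : R) : R := if 0 < x then f x else 0.

Lemma measurable_ext0 (f : R -> R) :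
  measurable_fun setT f -> measurable_fun setT (ext0 f).
Proof.
move=> mf; have -> : ext0 f = f \_ `]0, +oo[.
  by apply/funext => x; rewrite patchE /ext0 mem_setE in_itv/= andbT.
by apply/(measurable_restrictT f) => //; exact: measurable_funTS.
Qed.

Lemma continuous_bounded (F : R -> R) (T : R) : continuous F ->
  exists2 M, 0 <= M & forall x, `|x| <= T -> `|F x| <= M.
Proof.
move=> cF; have [T0|T0] := leP 0 T; last first.
  by exists 0 => // x xT; have := le_lt_trans xT T0; rewrite ltNge normr_ge0.
have cN : {within `[-T, T], continuous (fun x => `|F x|)}.
  by apply: continuous_subspaceT => x; apply: continuous_comp;
    [exact: cF|exact: norm_continuous].
have [c _ cM] := EVT_max (ge0_cp T0).2 cN.
exists `|F c|; first exact: normr_ge0.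
by move=> x; rewrite ler_norml => xT; apply: cM; rewrite in_itv.
Qed.

(** Controls the non-singular factor of the beta weight; passing to the exponent [- |r|] treats both
    signs of [r] at once. *)
Lemma powR_half_le (r x : R) : 2^-1 <= x <= 1 -> x `^ r <= ((2^-1) `^ `|r|)^-1.
Proof.
move=> /andP[hx x1]; have x0 : 0 < x by apply: lt_le_trans hx; rewrite invr_gt0.
apply: (@le_trans _ _ (x `^ (- `|r|))).
  by apply: ger_powR; rewrite ?x0// lerNl -normrN ler_norm.
rewrite powRN lef_pV2 ?posrE ?powR_gt0// ?invr_gt0//.
by apply: ge0_ler_powR; rewrite ?nnegrE ?invr_ge0// ltW.
Qed.

Definition powR_ext0 (p : R) : R -> R := ext0 (fun s => s `^ (p - 1)).

Lemma powR_ext0_ge0 p s : 0 <= powR_ext0 p s.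
Proof. by rewrite /powR_ext0 /ext0; case: ifP => // _; exact: powR_ge0. Qed.

Lemma measurable_powR_ext0 p : measurable_fun setT (powR_ext0 p).
Proof. by apply: measurable_ext0; exact: measurable_powR. Qed.

(** The integrand of Euler's beta function [B(p, q)], equal to 0 outside []0, 1[]. *)
Definition beta_weight (p q s : R) := powR_ext0 p (1 - s) * powR_ext0 q s.

Lemma beta_weight_ge0 p q s : 0 <= beta_weight p q s.
Proof. by rewrite mulr_ge0// powR_ext0_ge0. Qed.

Lemma beta_weight_out p q s : ~~ (0 < s < 1) -> beta_weight p q s = 0.
Proof.
rewrite /beta_weight /powR_ext0 /ext0 subr_gt0.
by case: (0 < s); case: (s < 1); rewrite ?mulr0 ?mul0r.
Qed.

Lemma measurable_beta_weight p q : measurable_fun setT (beta_weight p q).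
Proof.
apply: measurable_funM; last exact: measurable_powR_ext0.
have -> : (fun x => powR_ext0 p (1 - x)) = powR_ext0 p \o (fun x => (-1) * x + 1).
  by apply/funext => x /=; rewrite mulN1r addrC.
exact: measurableT_comp (measurable_powR_ext0 p) (measurable_affine _ _).
Qed.

Lemma integrable_beta_weight p q : 0 < p -> 0 < q ->
  mu.-integrable setT (EFin \o beta_weight p q).
Proof.
move=> p0 q0.
pose v (r : R) : R -> R := (fun s => s `^ (r - 1)) \_ `]0, 1[.
have iv r : 0 < r -> mu.-integrable setT (EFin \o v r).
  move=> r0; rewrite /v -restrict_EFin.
  apply/integrable_restrict => //=; rewrite setTI.
  exact: integrable_powR01.
have iv1 r : 0 < r -> mu.-integrable setT (fun s => (v r (1 - s))%:E).
  move=> r0; have := @integrable_affine R (-1) 1 _ _ (iv _ r0).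
  rewrite oppr_eq0 oner_eq0 => /(_ isT).
  by under eq_fun do rewrite /= mulN1r addrC.
pose K (r : R) := ((2^-1 : R) `^ `|r - 1|)^-1.
have K0 r : 0 <= K r by rewrite invr_ge0 powR_ge0.
have v0 r s : 0 <= v r s.
  by rewrite /v patchE; case: ifP => // _; exact: powR_ge0.
(* On each half of [0 < s < 1] only one of the two factors is singular. *)
apply: (@le_integrable _ _ _ mu setT _ _
  (fun s => (K p)%:E * (v q s)%:E + (K q)%:E * (v p (1 - s))%:E)%E) => //.
- by apply/measurable_EFinP; exact: measurable_beta_weight.
- move=> s _; rewrite /= lee_fin !ger0_norm ?beta_weight_ge0 ?addr_ge0 ?mulr_ge0//.
  have [/andP[s0 s1]|/beta_weight_out->] := boolP (0 < s < 1); last first.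
    by rewrite addr_ge0 ?mulr_ge0.
  rewrite /beta_weight /powR_ext0 /ext0 subr_gt0 s0 s1 /v !patchE.
  rewrite !mem_setE !in_itv/= subr_gt0 s0 s1/= gtrBl s0.
  have [sh|sh] := leP s 2^-1.
  + rewrite -[leLHS]addr0 lerD ?mulr_ge0 ?powR_ge0// ler_wpM2r ?powR_ge0//.
    by apply: powR_half_le; lra.
  + rewrite -[leLHS]add0r lerD ?mulr_ge0 ?powR_ge0// mulrC ler_wpM2r ?powR_ge0//.
    by apply: powR_half_le; lra.
- by apply: integrableD => //; apply: integrableZl => //; [exact: iv|exact: iv1].
Qed.

Variables (p q : R) (F G : R -> R).
Hypotheses (p0 : 0 < p) (q0 : 0 < q) (cF : continuous F) (cG : continuous G).

Definition beta_integrand (t s : R) : R :=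
  beta_weight p q s * (F (t * (1 - s)) * G (t * s)).

Lemma measurable_beta_integrand t : measurable_fun setT (beta_integrand t).
Proof.
apply: measurable_funM; first exact: measurable_beta_weight.
have mc (H : R -> R) (c d : R) : continuous H ->
    measurable_fun setT (fun s : R => H (c * s + d)).
  move=> cH; apply: (measurableT_comp (f := H)) (measurable_affine c d).
  exact: continuous_measurable_fun.
apply: measurable_funM.
- have -> : (fun s => F (t * (1 - s))) = (fun s => F (- t * s + t)).
    by apply/funext => s; congr F; ring.
  exact: mc.
- have -> : (fun s => G (t * s)) = (fun s => G (t * s + 0)).
    by apply/funext => s; rewrite addr0.
  exact: mc.
Qed.

(** For [0 < s < 1] both [t * (1 - s)] and [t * s] stay in [[-T, T]], where [F] and [G] are bounded.
    The bound is uniform in [t], as dominated convergence requires. *)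
Lemma beta_integrand_dominated (T : R) : exists2 M, 0 <= M &
  forall t s, `|t| <= T -> `|beta_integrand t s| <= beta_weight p q s * M.
Proof.
have [M M0 MF] := continuous_bounded T cF.
have [N N0 NG] := continuous_bounded T cG.
exists (M * N); first exact: mulr_ge0.
move=> t s tT; rewrite /beta_integrand.
have [/andP[s0 s1]|/beta_weight_out->] := boolP (0 < s < 1); last first.
  by rewrite !mul0r normr0.
rewrite normrM ger0_norm ?beta_weight_ge0// ler_wpM2l ?beta_weight_ge0//.
rewrite normrM ler_pM//.
- apply: MF; rewrite normrM (le_trans _ tT)// ler_piMr// ger0_norm; lra.
- apply: NG; rewrite normrM (le_trans _ tT)// ler_piMr// ger0_norm; lra.
Qed.

Lemma integrable_beta_integrand t :
  mu.-integrable setT (EFin \o beta_integrand t).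
Proof.
have [M M0 MD] := beta_integrand_dominated `|t|.
apply: (@le_integrable _ _ _ mu setT _ _
  (fun s => M%:E * (beta_weight p q s)%:E)%E) => //.
- by apply/measurable_EFinP; exact: measurable_beta_integrand.
- move=> s _ /=; rewrite lee_fin [leRHS]ger0_norm; last first.
    by rewrite mulr_ge0// beta_weight_ge0.
  by rewrite mulrC; exact: MD.
- by apply: integrableZl => //; exact: integrable_beta_weight.
Qed.

Definition beta_integral (t : R) : R := (\int[mu]_s beta_integrand t s)%R.

Lemma continuous_beta_integral : continuous beta_integral.
Proof.
(* Continuity is local, so domination on one bounded open interval []- T, T[] around [t]
   suffices. *)
move=> t; pose T := `|t| + 1.
have [M M0 MD] := beta_integrand_dominated T.
have IT x : (`]- T, T[ : set R) x -> `|x| <= T.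
  by rewrite /= in_itv/= -ltr_norml => /ltW.
have cl (H : R -> R) c : continuous H -> continuous (fun x : R => H (x * c)).
  have cm : continuous (fun x : R => x * c).
    by move=> x; apply: cvgM; [exact: cvg_id|exact: cvg_cst].
  by move=> cH x; exact: continuous_comp (cm x) (cH _).
have cb s : continuous (beta_integrand^~ s).
  move=> x; apply: cvgM; first exact: cvg_cst.
  by apply: cvgM; exact: cl.
have tI : t \in (`]- T, T[ : set R).
  by rewrite mem_setE in_itv/= -ltr_norml /T ltrDl.
apply: (@continuity_under_integral R _ _ mu beta_integrand setT _ (- T) T _ _
  (fun s => beta_weight p q s * M)) => //.
- by move=> x _; exact: integrable_beta_integrand.
- by apply/aeW => s _ x _; exact: cb.
- have -> : EFin \o (fun s => beta_weight p q s * M) =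
      (fun s => M%:E * (beta_weight p q s)%:E)%E.
    by apply/funext => s; rewrite /= mulrC.
  by apply: integrableZl => //; exact: integrable_beta_weight.
- by move=> x xI; apply/aeW => s _; apply: MD; exact: IT.
Qed.
End ZeroExtension.

(** * The convolution algebra [C_m1] *)

Section LaplaceConvolution.
Set Implicit Arguments.
Unset Strict Implicit.
Context {R : realType}.
Let mu := @lebesgue_measure R.
Implicit Types f g h : R -> R.

(* Precomposing with [normr] extends the regular factor continuously to [R]. *)
Lemma C_m1_regular f : C_m1 f -> exists p F, [/\ 0 < p, continuous F &
  forall t, ext0 f t = powR_ext0 p t * F t].
Proof.
move=> [p [f1 [p0 cf1 fE]]]; exists p, (fun t => f1 `|t|); split => // [x|t].
  have xI : (`[0, +oo[ : set R) `|x| by rewrite /= in_itv/= normr_ge0.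
  (* Continuity at [|x|] is relative to [[0, +oo[]; the neighbourhood filter is unfolded and pulled
     back along the norm, whose values all lie in that half-line. *)
  have cfx := cf1 `|x|; rewrite /continuous_at/= in cfx.
  apply: cvg_trans cfx => A.
  rewrite /fmap/= /nbhs/= -(nbhs_subspace_in xI) /within/= => HA.
  have {}HA : \forall z \near x, (`[0, +oo[ : set R) `|z| -> A (f1 `|z|).
    exact: (@norm_continuous _ _ x _ HA).
  change (\forall z \near x, A (f1 `|z|)).
  apply: filterS HA => z; apply.
  by rewrite /= in_itv/= normr_ge0.
rewrite /powR_ext0 /ext0; case: ifPn => [t0|]; last by rewrite mul0r.
by rewrite fE// gtr0_norm.
Qed.

Lemma C_m1_intro f p F : 0 < p -> continuous F ->
  (forall t, 0 < t -> f t = t `^ (p - 1) * F t) -> C_m1 f.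
Proof.
by move=> p0 cF fE; exists p, F; split => //; exact: continuous_subspaceT.
Qed.

(** Serves the absolute integrability needed for Fubini in [laplace_convA]. *)
Lemma C_m1_abs f : C_m1 f -> C_m1 (fun x => `|f x|).
Proof.
move=> /C_m1_regular[p [F [p0 cF fE]]].
apply: (@C_m1_intro _ p (fun x => `|F x|)) => // [x|t t0].
  by apply: continuous_comp; [exact: cF|exact: norm_continuous].
have := fE t; rewrite /powR_ext0 /ext0 t0 => ->.
by rewrite normrM ger0_norm// powR_ge0.
Qed.

Lemma measurable_C_m1 f : C_m1 f -> measurable_fun setT (ext0 f).
Proof.
move=> /C_m1_regular[p [F [p0 cF /funext->]]]; apply: measurable_funM.
  exact: measurable_powR_ext0.
exact: continuous_measurable_fun.
Qed.

Lemma laplace_convE f g t :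
  laplace_conv f g t = (\int[mu]_x (ext0 f (t - x)%R * ext0 g x)%R)%R.
Proof.
rewrite /laplace_conv Rintegral_mkcond; apply: eq_Rintegral => x _.
rewrite patchE mem_setE in_itv/= /ext0 subr_gt0.
by case: (0 < x); case: (x < t); rewrite ?mul0r ?mulr0.
Qed.

Lemma laplace_conv_le0 f g t : t <= 0 -> laplace_conv f g t = 0.
Proof.
move=> t0; rewrite /laplace_conv set_itv_ge ?Rintegral_set0//.
by rewrite bnd_simp -leNgt.
Qed.

(** The interval []0, t[] is empty for [t <= 0], so a convolution nested in another one needs no
    further cut-off. *)
Lemma ext0_laplace_conv f g : ext0 (laplace_conv f g) = laplace_conv f g.
Proof.
by apply/funext => t; rewrite /ext0; case: ltP => // /laplace_conv_le0->.
Qed.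

Lemma powR_ext0M (p t u : R) : 0 < t ->
  powR_ext0 p (t * u) = t `^ (p - 1) * powR_ext0 p u.
Proof.
move=> t0; rewrite /powR_ext0 /ext0 pmulr_rgt0//.
by case: ifPn => u0; rewrite ?mulr0// powRM// ltW.
Qed.

Section Scaling.
Variables (f g : R -> R) (p q : R) (F G : R -> R).
Hypotheses (p0 : 0 < p) (q0 : 0 < q) (cF : continuous F) (cG : continuous G).
Hypotheses (fE : forall t, ext0 f t = powR_ext0 p t * F t).
Hypotheses (gE : forall t, ext0 g t = powR_ext0 q t * G t).
Variable t : R.
Hypothesis t0 : 0 < t.

Let c := t `^ (p - 1) * t `^ (q - 1).

(** The substitution [x = t * s], written with a zero shift to match the affine lemmas. *)
Let scaledE : (fun x => (ext0 f (t - x) * ext0 g x)%:E) =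
  (fun x => (fun s => c%:E * (beta_integrand p q F G t s)%:E)%E (t^-1 * x + 0)).
Proof.
apply/funext => x; rewrite addr0; set s := t^-1 * x.
have -> : x = t * s by rewrite /s mulrA mulfV ?mul1r// gt_eqF.
rewrite -EFinM; congr EFin.
have -> : t - t * s = t * (1 - s) by ring.
rewrite fE gE (powR_ext0M p (1 - s) t0) (powR_ext0M q s t0).
rewrite /c /beta_integrand /beta_weight; ring.
Qed.

Let ibeta := integrable_beta_integrand p0 q0 cF cG t.

Let tV0 : t^-1 != 0. Proof. by rewrite invr_eq0 gt_eqF. Qed.

Lemma integrable_laplace_conv_gt0 :
  mu.-integrable setT (fun x => (ext0 f (t - x) * ext0 g x)%:E).
Proof.
rewrite scaledE.
exact: (integrable_affine t^-1 0 tV0 _ (integrableZl measurableT c ibeta)).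
Qed.

Lemma laplace_conv_beta :
  laplace_conv f g t = t `^ (p + q - 1) * beta_integral p q F G t.
Proof.
have mb : measurable_fun setT (fun s => c%:E * (beta_integrand p q F G t s)%:E)%E.
  by have /integrableP[] := integrableZl measurableT c ibeta.
rewrite laplace_convE /Rintegral scaledE.
have := integral_affine t^-1 0 tV0 _ mb; rewrite -/mu.
set I := integral _ _ _ => IE.
have : I = (t%:E * (c%:E * (beta_integral p q F G t)%:E))%E.
  rewrite /beta_integral /Rintegral fineK; last exact: integrable_fin_num.
  rewrite -[X in (_ * X)%E]integralZl// -IE muleA -EFinM gtr0_norm ?invr_gt0//.
  by rewrite mulfV ?gt_eqF// mul1e.
move=> ->; rewrite -!EFinM/= mulrA; congr (_ * _).
(* The Jacobian [t] raises the exponent [(p - 1) + (q - 1)] to [p + q - 1]. *)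
have tE : t = t `^ 1 by rewrite powRr1// ltW.
have tn : t != 0 by rewrite gt_eqF.
rewrite [X in X * _]tE /c -!powRD ?tn ?implybT//; congr (_ `^ _); ring.
Qed.
End Scaling.

Lemma integrable_laplace_conv f g t : C_m1 f -> C_m1 g ->
  mu.-integrable setT (fun x => (ext0 f (t - x) * ext0 g x)%:E).
Proof.
move=> /C_m1_regular[p [F [p0 cF fE]]] /C_m1_regular[q [G [q0 cG gE]]].
have [t0|t0] := ltP 0 t; first exact: (@integrable_laplace_conv_gt0 f g p q F G).
(* For [t <= 0] the conditions [0 < x] and [x < t] exclude each other. *)
rewrite [X in integrable _ _ X](_ : _ = cst 0%E); first exact: integrable0.
apply/funext => x /=; congr EFin; rewrite /ext0.
case: ifPn => [tx|_]; last by rewrite mul0r.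
by case: ifPn => [x0|_]; rewrite ?mulr0//; lra.
Qed.

Lemma integral_laplace_conv f g t : C_m1 f -> C_m1 g ->
  (\int[mu]_x (ext0 f (t - x)%R * ext0 g x)%:E)%E = (laplace_conv f g t)%:E.
Proof.
move=> fC gC; rewrite laplace_convE /Rintegral fineK//.
by apply: integrable_fin_num => //; exact: integrable_laplace_conv.
Qed.

Lemma C_m1_laplace_conv f g : C_m1 f -> C_m1 g -> C_m1 (laplace_conv f g).
Proof.
move=> /C_m1_regular[p [F [p0 cF fE]]] /C_m1_regular[q [G [q0 cG gE]]].
apply: (@C_m1_intro _ (p + q) (beta_integral p q F G)).
- exact: addr_gt0.
- exact: continuous_beta_integral.
- by move=> t t0; exact: laplace_conv_beta.
Qed.

(** The reflection of [x] to [t - x] exchanges the two factors. *)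
Lemma laplace_convC f g t : C_m1 f -> C_m1 g ->
  laplace_conv f g t = laplace_conv g f t.
Proof.
move=> fC gC; apply: EFin_inj; rewrite -!integral_laplace_conv//.
have [mI _] := integrableP _ _ _ (integrable_laplace_conv t gC fC).
rewrite -(integral_affine (-1) t _ _ mI) ?oppr_eq0 ?oner_eq0// normrN normr1 mul1e.
apply: eq_integral => x _; rewrite mulrC; congr (ext0 _ _ * ext0 _ _)%:E; ring.
Qed.

(** The plane integrand of the triple convolution; the cut-offs encode the triangle
    [0 < z.2 < z.1 < t]. *)
Let K f g h t (z : R * R) : \bar R :=
  (ext0 f (t - z.1) * (ext0 g (z.1 - z.2) * ext0 h z.2))%:E.

Let measurable_K f g h t : C_m1 f -> C_m1 g -> C_m1 h ->
  measurable_fun setT (K f g h t).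
Proof.
move=> /measurable_C_m1 mf /measurable_C_m1 mg /measurable_C_m1 mh.
apply/measurable_EFinP; apply: measurable_funM.
  apply: (measurableT_comp mf); exact: measurable_funB.
apply: measurable_funM; last exact: measurableT_comp.
by apply: (measurableT_comp mg); exact: measurable_funB.
Qed.

Let integral_K f g h t : C_m1 f -> C_m1 g -> C_m1 h ->
  (\int[mu]_x \int[mu]_s K f g h t (x, s))%E =
  (laplace_conv f (laplace_conv g h) t)%:E.
Proof.
move=> fC gC hC; rewrite -integral_laplace_conv//; last exact: C_m1_laplace_conv.
rewrite ext0_laplace_conv; apply: eq_integral => x _; rewrite EFinM.
rewrite -integral_laplace_conv// -integralZl//.
exact: integrable_laplace_conv.
Qed.

(** The iterated integral of [|K|] is the triple convolution of the absolute values, again in [C_m1]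
    and hence finite; Tonelli makes [K] integrable and Fubini swaps the order. *)
Lemma laplace_convA f g h t : C_m1 f -> C_m1 g -> C_m1 h ->
  laplace_conv f (laplace_conv g h) t = laplace_conv (laplace_conv f g) h t.
Proof.
move=> fC gC hC; apply: EFin_inj.
have absE k x : `|ext0 k x| = ext0 (fun x => `|k x|) x.
  by rewrite /ext0; case: ifP => // _; rewrite normr0.
have iK : (mu \x mu)%E.-integrable setT (K f g h t).
  apply/integrable12ltyP; first exact: measurable_K.
  under eq_integral do under eq_integral do
    rewrite /= !normrM !absE.
  have := integral_K t (C_m1_abs fC) (C_m1_abs gC) (C_m1_abs hC).
  by rewrite /K/= => ->; rewrite ltry.
rewrite -integral_K// (Fubini iK) -[RHS]integral_laplace_conv//; last first.
  exact: C_m1_laplace_conv.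
rewrite ext0_laplace_conv; apply: eq_integral => s _; rewrite EFinM.
rewrite -integral_laplace_conv// -integralZr//; last exact: integrable_laplace_conv.
have mI : measurable_fun setT (fun x => K f g h t (x, s)).
  exact: (measurableT_comp (measurable_K t fC gC hC) (measurable_pair2 s)).
(* The translation by [s] turns the inner integral into that of [f * g] at [t - s]. *)
rewrite -(integral_affine 1 s _ _ mI) ?oner_eq0// normr1 mul1e.
apply: eq_integral => x _; rewrite /K/= -EFinM mulrA.
congr (ext0 _ _ * ext0 _ _ * _)%:E; ring.
Qed.
End LaplaceConvolution.

(** * Iterated convolutions and repeated integration *)

Section IteratedConvolution.
Set Implicit Arguments.
Unset Strict Implicit.
Context {R : realType}.
Let mu := @lebesgue_measure R.
Implicit Types f g h k kappa phi : R -> R.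

(** Integration from 0. *)
Let I1 : (R -> R) -> R -> R := laplace_conv (cst 1).

Lemma eq_ext0 f g : (forall t, 0 < t -> f t = g t) -> ext0 f = ext0 g.
Proof. by move=> fg; apply/funext => t; rewrite /ext0; case: ifPn => // /fg. Qed.

(** Permits substituting inside a convolution identities that are known only on the positive
    half-line, such as the Sonine condition. *)
Lemma eq_laplace_conv f f' g g' : ext0 f = ext0 f' -> ext0 g = ext0 g' ->
  laplace_conv f g = laplace_conv f' g'.
Proof. by move=> ff gg; apply/funext => t; rewrite !laplace_convE ff gg. Qed.

Lemma C_m1_0S : @C_m1_0 R `<=` C_m1.
Proof. by move=> f [p [F [/andP[p0 _] cF fE]]]; exists p, F. Qed.

Lemma C_m1_cst1 : C_m1 (cst 1 : R -> R).
Proof.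
exists 1, (cst 1); split => // [|t _]; last by rewrite subrr powRr0 mul1r.
by apply: continuous_subspaceT => x; exact: cvg_cst.
Qed.

Lemma C_m1_iter kappa n f : C_m1 kappa -> C_m1 f ->
  C_m1 (iter n (laplace_conv kappa) f).
Proof.
by move=> kC fC; elim: n => //= n; exact: C_m1_laplace_conv.
Qed.

Lemma laplace_conv_left_comm f g h : C_m1 f -> C_m1 g -> C_m1 h ->
  laplace_conv f (laplace_conv g h) = laplace_conv g (laplace_conv f h).
Proof.
move=> fC gC hC; apply/funext => t; rewrite !laplace_convA//.
congr (laplace_conv _ h t); apply/funext => x; exact: laplace_convC.
Qed.

Lemma laplace_conv_iter kappa k n f : C_m1 kappa -> C_m1 k -> C_m1 f ->
  laplace_conv kappa (iter n (laplace_conv k) f) =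
  iter n (laplace_conv k) (laplace_conv kappa f).
Proof.
move=> kaC kC fC; elim: n => //= n <-.
by rewrite laplace_conv_left_comm//; exact: C_m1_iter.
Qed.

(** Associativity, applied once per factor. Positivity of [n] matters: [conv_pow k 0] is [k], not a
    unit. *)
Lemma laplace_conv_pow k n f : C_m1 k -> C_m1 f -> (0 < n)%N ->
  laplace_conv (conv_pow k n) f = iter n (laplace_conv k) f.
Proof.
move=> kC fC; case: n => // n _; rewrite /conv_pow/=.
elim: n => //= n <-; apply/funext => t.
by rewrite laplace_convA//; exact: C_m1_iter.
Qed.

(** Commutativity brings the outermost [kappa] next to the outermost [k]; together they act as one
    integration, and induction treats the rest. *)
Lemma iter_sonine kappa k n f : C_m1 kappa -> C_m1 k -> C_m1 f ->
  (forall t, 0 < t -> laplace_conv kappa k t = 1) ->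
  iter n (laplace_conv k) (iter n (laplace_conv kappa) f) = iter n I1 f.
Proof.
move=> kaC kC fC kk1; elim: n => //= n IH.
have iC m : C_m1 (iter m (laplace_conv kappa) f) by exact: C_m1_iter.
have jC : C_m1 (iter n (laplace_conv k) (iter n (laplace_conv kappa) f)).
  exact: C_m1_iter.
rewrite -laplace_conv_iter// laplace_conv_left_comm// IH.
have i1C : C_m1 (iter n I1 f) by apply: C_m1_iter => //; exact: C_m1_cst1.
transitivity (laplace_conv (laplace_conv kappa k) (iter n I1 f)).
  by apply/funext => t; rewrite laplace_convA.
by apply: eq_laplace_conv => //; exact: eq_ext0.
Qed.

Lemma continuous_C_m1 f x : C_m1 f -> 0 < x -> {for x, continuous (ext0 f)}.
Proof.
move=> /C_m1_regular[p [F [p0 cF fE]]] x0.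
have cp : {for x, continuous (fun z => z `^ (p - 1) * F z)}.
  by apply: cvgM; [exact: continuous_powR_gt0|exact: cF].
have xE : ext0 f x = x `^ (p - 1) * F x by rewrite fE /powR_ext0 /ext0 x0.
suff : ext0 f z @[z --> x] --> ext0 f x by [].
rewrite xE; apply: cvg_trans cp; apply: near_eq_cvg.
near=> z; rewrite fE /powR_ext0 /ext0 ifT//.
by near: z; exact: lt_nbhsr.
Unshelve. all: by end_near. Qed.

(** On []0, u]] the integrand of [1 * f] at [u + 1] is [f] itself; evaluating beyond [u] keeps the
    end point [u] inside the cut-off. *)
Lemma integrable_C_m1 f u : C_m1 f ->
  mu.-integrable `]0, u] (EFin \o ext0 f).
Proof.
move=> fC; have iT := integrable_laplace_conv (u + 1) C_m1_cst1 fC.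
have : mu.-integrable `]0, u] (fun x => (ext0 (cst 1) (u + 1 - x) * ext0 f x)%:E).
  exact: integrableS iT.
apply: eq_integrable => // x; rewrite mem_setE in_itv/= => /andP[x0 xu].
by rewrite /ext0 x0 subr_gt0 ifT ?mul1r// (le_lt_trans xu)// ltrDl.
Qed.

Lemma laplace_conv1_derive f t : C_m1 f -> 0 < t ->
  derivable (I1 f) t 1 /\ (I1 f)^`() t = f t.
Proof.
move=> fC t0.
have I1E : I1 f = fun t => (\int[mu]_(x in `]0, t]) ext0 f x)%R.
  apply/funext => x; rewrite -Rintegral_itv_bndo_bndc; last first.
    have := integrable_C_m1 x fC; apply: integrableS => //.
    by apply: subset_itvl; rewrite bnd_simp.
  apply: eq_Rintegral => y; rewrite mem_setE in_itv/= => /andP[y0 _].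
  by rewrite mul1r /ext0 y0.
rewrite I1E; have -> : f t = ext0 f t by rewrite /ext0 t0.
(* The left end 0 is excluded, since [f] may be singular there; [t + 1] is just some point beyond
   [t]. *)
apply: (@continuous_FTC1 _ (ext0 f) (BRight 0) t (t + 1)).
- by rewrite ltrDl.
- exact: integrable_C_m1.
- by rewrite lte_fin.
- exact: continuous_C_m1.
Qed.

Lemma laplace_conv1_cvg0 f : C_m1 f -> I1 f t @[t --> 0^'+] --> (0 : R).
Proof.
move=> /C_m1_regular[q [F [q0 cF fE]]].
have c1 : continuous (cst 1 : R -> R) by move=> x; exact: cvg_cst.
have oneE t : ext0 (cst 1) t = powR_ext0 1 t * (cst 1 t : R).
  by rewrite /powR_ext0 /ext0; case: ifPn => _; rewrite ?mul0r// subrr powRr0 mul1r.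
have cH := continuous_beta_integral ltr01 q0 c1 cF.
have : t `^ q * beta_integral 1 q (cst 1) F t @[t --> 0^'+] -->
    0 * beta_integral 1 q (cst 1) F 0.
  apply: cvgM; first exact: powR_cvg0.
  by apply: cvg_at_right_filter; exact: cH.
rewrite mul0r; apply: cvg_trans; apply: near_eq_cvg.
near=> t; have t0 : 0 < t by near: t; exact: nbhs_right_gt.
rewrite /I1 (laplace_conv_beta ltr01 q0 c1 cF oneE fE t0).
by congr (_ `^ _ * _); ring.
Unshelve. all: by end_near. Qed.

(** Each derivative removes one integration. The formula for the previous derivative is known only
    at positive points, which is enough because they form an open set and differentiation is
    local. *)
Lemma derive1n_iter_laplace_conv1 f n j t : C_m1 f -> (j <= n)%N -> 0 < t ->
  (iter n I1 f)^`(j) t = iter (n - j) I1 f t /\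
  ((j < n)%N -> derivable (iter n I1 f)^`(j) t 1).
Proof.
move=> fC; set D := iter n I1 f.
have near_pos (P : R -> Prop) (x : R) : (forall z, 0 < z -> P z) -> 0 < x ->
    \forall z \near x, P z.
  by move=> HP x0; near=> z; apply: HP; near: z; exact: lt_nbhsr.
have step i (x : R) : (forall z, 0 < z -> D^`(i) z = iter (n - i) I1 f z) ->
    (i < n)%N -> 0 < x ->
    derivable D^`(i) x 1 /\ D^`(i.+1) x = iter (n - i.+1) I1 f x.
  move=> DE ltin x0; have nE : (n - i = (n - i.+1).+1)%N by lia.
  have iC : C_m1 (iter (n - i.+1) I1 f) by exact: C_m1_iter C_m1_cst1 fC.
  have [dI EI] := laplace_conv1_derive iC x0.
  have DI : \forall z \near x, D^`(i) z = I1 (iter (n - i.+1) I1 f) z.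
    by apply: near_pos x0 => z /DE ->; rewrite nE.
  split.
    by apply: near_eq_derivable dI; apply: filterS DI => z ->.
  by rewrite derive1nS -EI !derive1E; exact: near_eq_derive.
have E i (x : R) : (i <= n)%N -> 0 < x -> D^`(i) x = iter (n - i) I1 f x.
  elim: i x => [|i IH] x lein x0; first by rewrite subn0.
  by have [_ ->] := step i x (fun z => IH z (ltnW lein)) lein x0.
move=> lejn t0; split; first exact: E.
by move=> ltjn; have [] := step j t (fun z => E j z lejn) ltjn t0.
Unshelve. all: by end_near. Qed.
End IteratedConvolution.

(** * Left inverses in the Riemann-Liouville and Caputo senses *)

Theorem theorem4p4 (R : realType) (kappa k : R -> R) (n : nat) :
  sonine_kernels kappa -> associate_kernel kappa k -> (0 < n)%N ->
  (forall f : R -> R, C_m1 f ->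
     GFD_RL_exists k n (GFI kappa n f) /\
     forall t : R, 0 < t -> GFD_RL k n (GFI kappa n f) t = f t) /\
  (forall f : R -> R, C_m1_pow k n f ->
     GFD_C_exists k n (GFI kappa n f) /\
     forall t : R, 0 < t -> GFD_C k n (GFI kappa n f) t = f t).
Proof.
move=> [/C_m1_0S kaC _] [/C_m1_0S kC kk1] n0.
(* The Caputo part uses [iter_sonine] with the two kernels exchanged. *)
have kk1' t : 0 < t -> laplace_conv k kappa t = 1.
  by move=> t0; rewrite laplace_convC// kk1.
have RL f : C_m1 f -> GFD_RL_exists k n (GFI kappa n f) /\
    forall t : R, 0 < t -> GFD_RL k n (GFI kappa n f) t = f t.
  move=> fC; rewrite /GFD_RL_exists /GFD_RL /GFI laplace_conv_pow//; last first.
    exact: C_m1_iter.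
  rewrite iter_sonine//; split => [i ltin t t0|t t0].
    by have [_ /(_ ltin)] := derive1n_iter_laplace_conv1 fC (ltnW ltin) t0.
  by have [-> _] := derive1n_iter_laplace_conv1 fC (leqnn n) t0; rewrite subnn.
split=> // f [phi phiC fE].
have gC : C_m1 (GFI k n phi) by exact: C_m1_iter.
have fC : C_m1 f.
  by have [p [F [p0 cF gE]]] := gC; exists p, F; split=> // t t0; rewrite fE// gE.
have DE : GFI kappa n f = iter n (laplace_conv (cst 1)) phi.
  rewrite -(iter_sonine n kC kaC phiC kk1') /GFI.
  (* [f] agrees with [k^n * phi] only for [t > 0], so the innermost convolution is exposed, where
     such agreement suffices; this uses [0 < n]. *)
  rewrite -(prednK n0) [LHS]iterSr [RHS]iterSr; congr iter.
  by apply: eq_laplace_conv => //; rewrite prednK//; exact: eq_ext0.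
have [RLex RLE] := RL f fC.
have D0 j : (j < n)%N ->
    (GFI kappa n f)^`(j) t @[t --> 0^'+] --> (0 : R).
  (* As [j < n], the derivative of order [j] still carries at least one integration, applied to this
     [C_m1] function. *)
  move=> ltjn; have iC : C_m1 (iter (n - j.+1) (laplace_conv (cst 1)) phi).
    by apply: C_m1_iter => //; exact: C_m1_cst1.
  rewrite DE; have := laplace_conv1_cvg0 iC; apply: cvg_trans; apply: near_eq_cvg.
  near=> t; have t0 : 0 < t by near: t; exact: nbhs_right_gt.
  have [-> _] := derive1n_iter_laplace_conv1 phiC (ltnW ltjn) t0.
  by rewrite (_ : (n - j = (n - j.+1).+1)%N)//; lia.
have L0 j : (j < n)%N -> deriv_at0 j (GFI kappa n f) = 0.
  by move=> ltjn; apply/cvg_lim; [exact: Rhausdorff|exact: D0].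
split.
  split => //.
  - rewrite DE => i lti t t0.
    have ltin : (i < n)%N by lia.
    by have [_ /(_ ltin)] := derive1n_iter_laplace_conv1 phiC (ltnW ltin) t0.
  - by move=> j ltjn; apply/cvg_ex; exists 0; exact: D0.
  - by move=> j ltjn; rewrite L0// eqxx.
move=> t t0; rewrite /GFD_C RLE// big1 ?subr0// => j _.
by rewrite L0// mul0r.
Unshelve. all: by end_near. Qed.
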